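(* The system $\textsf{M}$ proves: every standard extensional type two functional is nonstandard uniformly continuous on Cantor space, i.e. for every $\varphi^2$ satisfying $(\forall^{\mathrm{st}}f^1,g^1)(f\approx_1g\to\varphi(f)=_0\varphi(g))$ we have $$(\forall f^1,g^1\le_11)(f\approx_1g\to\varphi(f)=\varphi(g)).$$ The same holds for any standard compact subspace of Baire space, i.e. with $f,g\le_11$ replaced by $f,g\le_1h_0$ for any fixed standard $h_0^1$.
   Context: $f\approx_1g$ means $(\forall^{\mathrm{st}}n^0)(f(n)=g(n))$; $f\le_1h$ means $(\forall n^0)(f(n)\le h(n))$, and $f\le_11$ means $f(n)\le1$ for all $n$. A standard compact subspace of Baire space is a set $\{f^1:f\le_1h_0\}$ for fixed standard $h_0$. Type $0$ is the type of natural numbers, $1$ is $0\to0$, $2$ is $1\to0$; superscripts denote types. $\textsf{E-PA}^{\omega}$ is classical Peano arithmetic in all finite types with the axiom of extensionality. Strong majorizability $\le^*$: $x\le^*_0y$ is $x\le_0y$, and $x\le^*_{\rho\to\sigma}y$ is $(\forall v)(\forall u\le^*_\rho v)(xu\le^*_\sigma yv\wedge yu\le^*_\sigma yv)$. An object $x$ is monotone if $x\le^*x$; $\tilde\forall,\tilde\exists$ denote quantifiers over monotone objects. The language of $\textsf{E-PA}^{\omega}_{\mathrm{st}}$ adds a predicate $\mathrm{st}^\sigma$ (``is standard'') for each finite type $\sigma$. A formula is internal if it does not involve $\mathrm{st}$. $(\forall^{\mathrm{st}}x)\Phi$ is $(\forall x)(\mathrm{st}(x)\to\Phi)$ and $(\exists^{\mathrm{st}}x)\Phi$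 is $(\exists x)(\mathrm{st}(x)\wedge\Phi)$. $\textsf{E-PA}^{\omega}_{\mathrm{st}}$ is $\textsf{E-PA}^{\omega}$ plus: (1) $x=_\sigma y\to(\mathrm{st}(x)\to\mathrm{st}(y))$; (2) $\mathrm{st}(y)\to(x\le^*_\sigma y\to\mathrm{st}(x))$; (3) $\mathrm{st}(t)$ for each closed term $t$; (4) $\mathrm{st}(z^{\sigma\to\tau})\to(\mathrm{st}(x^\sigma)\to\mathrm{st}(zx))$; and external induction $\Phi(0)\wedge(\forall^{\mathrm{st}}n^0)(\Phi(n)\to\Phi(n+1))\to(\forall^{\mathrm{st}}n^0)\Phi(n)$ for any $\Phi$. $\textsf{M}$ is $\textsf{E-PA}^{\omega}_{\mathrm{st}}$ plus, for internal $\varphi$: monotone choice $\textsf{mAC}^\omega_{\mathrm{st}}$: $(\tilde\forall^{\mathrm{st}}x)(\tilde\exists^{\mathrm{st}}y)\varphi(x,y)\to(\tilde\exists^{\mathrm{st}}f)(\tilde\forall^{\mathrm{st}}x)(\exists y\le^*f(x))\varphi(x,y)$; realization $\textsf{R}^\omega$: $(\forall x)(\exists^{\mathrm{st}}y)\varphi(x,y)\to(\tilde\exists^{\mathrm{st}}z)(\forall x)(\exists y\le^*z)\varphi(x,y)$; and $\textsf{MAJ}^\omega_{\mathrm{st}}$: $(\forall^{\mathrm{st}}x)(\exists^{\mathrm{st}}y)(x\le^*y)$. *)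

(* Defs.v *)
From Stdlib Require Import List.
Import ListNotations.

Set Implicit Arguments.
Unset Strict Implicit.

(** A deep embedding of the many-sorted theories E-PA^omega, E-PA^omega_st and M.
    Syntax is intrinsically typed: variables are typed de Bruijn indices, and
    [term G s] / [form G] are the terms of type [s] / the formulas whose free
    variables are declared in the context [G]. *)

Inductive ty : Type :=
| N : ty
| Arr : ty -> ty -> ty.

Declare Scope ty_scope.
Delimit Scope ty_scope with ty.
Bind Scope ty_scope with ty.
Infix "⟶" := Arr (at level 55, right associativity) : ty_scope.
Open Scope ty_scope.

Definition Ty1 : ty := N ⟶ N.
Definition Ty2 : ty := Ty1 ⟶ N.

Definition ctx : Type := list ty.

Inductive var : ctx -> ty -> Type :=
| VZ : forall G s, var (s :: G) s
| VS : forall G r s, var G s -> var (r :: G) s.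
Arguments VZ {G s}.
Arguments VS {G r s} _.

(** [Pi], [Sigma] are the combinators usually written K and S; [Rec] is Goedel's
    recursor.  The equations they satisfy are in [EPA]. *)
Inductive term (G : ctx) : ty -> Type :=
| Var : forall s, var G s -> term G s
| App : forall r s, term G (r ⟶ s) -> term G r -> term G s
| Zero : term G N
| Succ : term G (N ⟶ N)
| Pi : forall r s, term G (r ⟶ s ⟶ r)
| Sigma : forall r s t, term G ((r ⟶ s ⟶ t) ⟶ (r ⟶ s) ⟶ r ⟶ t)
| Rec : forall r, term G (N ⟶ r ⟶ (r ⟶ N ⟶ r) ⟶ r).
Arguments Var {G s} _.
Arguments App {G r s} _ _.
Arguments Zero {G}.
Arguments Succ {G}.
Arguments Pi {G} r s.
Arguments Sigma {G} r s t.
Arguments Rec {G} r.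

(** Equality is primitive at type [N] only; [eqf] extends it pointwise. *)
Inductive form (G : ctx) : Type :=
| Eq0 : term G N -> term G N -> form G
| St : forall s, term G s -> form G
| Bot : form G
| Imp : form G -> form G -> form G
| And : form G -> form G -> form G
| Or : form G -> form G -> form G
| All : forall s, form (s :: G) -> form G
| Ex : forall s, form (s :: G) -> form G.
Arguments Bot {G}.
Arguments All {G} s _.
Arguments Ex {G} s _.

Declare Scope fo_scope.
Delimit Scope fo_scope with fo.
Infix "·" := App (at level 40, left associativity) : fo_scope.
Infix "≡" := Eq0 (at level 70, no associativity) : fo_scope.
Infix "∧" := And (at level 80, right associativity) : fo_scope.
Infix "∨" := Or (at level 85, right associativity) : fo_scope.
Infix "⇒" := Imp (at level 90, right associativity) : fo_scope.
Open Scope fo_scope.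

Fixpoint internal {G} (A : form G) : Prop :=
  match A with
  | Eq0 _ _ | Bot => True
  | St _ => False
  | Imp A B | And A B | Or A B => internal A /\ internal B
  | All s A | Ex s A => internal A
  end.

Definition sub (G D : ctx) : Type := forall s, var G s -> term D s.

Fixpoint tsub {G D} (f : sub G D) {s} (t : term G s) : term D s :=
  match t with
  | Var x => f _ x
  | App a b => App (tsub f a) (tsub f b)
  | Zero => Zero
  | Succ => Succ
  | Pi r s => Pi r s
  | Sigma r s t => Sigma r s t
  | Rec r => Rec r
  end.

Definition scons {G D r} (u : term D r) (f : sub G D) : sub (r :: G) D :=
  fun s x =>
    match x in var G' s'
      return match G' with
             | [] => unit
             | r' :: G'' => term D r' -> sub G'' D -> term D s'
             end
    with
    | VZ => fun u _ => u
    | VS y => fun _ f => f _ y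
    end u f.

Definition ids {G} : sub G G := fun s x => Var x.
Definition shift {G r} : sub G (r :: G) := fun s x => Var (VS x).
Definition none {G} : sub [] G :=
  fun s x => match x in var G' s' return match G' with [] => term G s' | _ => unit end with
             | VZ => tt
             | VS _ => tt
             end.

Definition wk {G r s} (t : term G s) : term (r :: G) s := tsub shift t.

Definition up {G D} r (f : sub G D) : sub (r :: G) (r :: D) :=
  scons (Var VZ) (fun s x => wk (f s x)).

Fixpoint fsub {G D} (f : sub G D) (A : form G) : form D :=
  match A with
  | Eq0 a b => Eq0 (tsub f a) (tsub f b)
  | St a => St (tsub f a)
  | Bot => Bot
  | Imp A B => Imp (fsub f A) (fsub f B)
  | And A B => And (fsub f A) (fsub f B)
  | Or A B => Or (fsub f A) (fsub f B)
  | All s A => All s (fsub (up f) A)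
  | Ex s A => Ex s (fsub (up f) A)
  end.

Definition fwk {G r} (A : form G) : form (r :: G) := fsub shift A.
Definition inst {G r} (A : form (r :: G)) (t : term G r) : form G := fsub (scons t ids) A.

Definition v0 {G a} : term (a :: G) a := Var VZ.
Definition v1 {G a b} : term (b :: a :: G) a := Var (VS VZ).

Fixpoint eqf {G} (s : ty) : term G s -> term G s -> form G :=
  match s return term G s -> term G s -> form G with
  | N => fun x y => x ≡ y
  | r ⟶ t => fun x y => All r (eqf (wk x · v0) (wk y · v0))
  end.
Arguments eqf {G s} _ _.

(** The step function below is [fun u v => u + 1], so that
    [plus x 0 = x] and [plus x (y + 1) = (plus x y) + 1]. *)
Definition plus {G} (x y : term G N) : term G N :=
  Rec N · y · x · (Sigma N N (N ⟶ N) · (Pi (N ⟶ N ⟶ N) N · Pi N N) · Succ).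

Definition le0 {G} (x y : term G N) : form G := Ex N (plus (wk x) v0 ≡ wk y).

(** Strong majorizability [x ≤* y]. *)
Fixpoint maj {G} (s : ty) : term G s -> term G s -> form G :=
  match s return term G s -> term G s -> form G with
  | N => fun x y => le0 x y
  | r ⟶ t => fun x y =>
      All r (All r (maj v0 v1 ⇒
        (maj (wk (wk x) · v0) (wk (wk y) · v1) ∧ maj (wk (wk y) · v0) (wk (wk y) · v1))))
  end.
Arguments maj {G s} _ _.

Definition AllSt {G} s (A : form (s :: G)) : form G := All s (St v0 ⇒ A).
Definition ExSt {G} s (A : form (s :: G)) : form G := Ex s (St v0 ∧ A).
Definition AllStM {G} s (A : form (s :: G)) : form G := AllSt (maj v0 v0 ⇒ A).
Definition ExStM {G} s (A : form (s :: G)) : form G := ExSt (maj v0 v0 ∧ A).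
(** [∃ y ≤* b, A], where [A] may mention [y] as index 0. *)
Definition ExMaj {G} s (b : term G s) (A : form (s :: G)) : form G := Ex s (maj v0 (wk b) ∧ A).
Arguments AllSt {G} s A.
Arguments ExSt {G} s A.
Arguments AllStM {G} s A.
Arguments ExStM {G} s A.

(** [skip2 A] is [A] with a fresh variable inserted below its two innermost ones. *)
Definition skip2 {G a b c} (A : form (b :: a :: G)) : form (b :: a :: c :: G) :=
  fsub (up (up shift)) A.

(** [at_succ A] is [A(n+1)] for [A = A(n)]. *)
Definition at_succ {G} (A : form (N :: G)) : form (N :: G) :=
  fsub (scons (Succ · v0) shift) A.

(** Axioms are given with arbitrary terms and parameters from any context, which
    amounts to taking universal closures. *)
Inductive EPA : forall G, form G -> Prop :=
| eq0_refl G (x : term G N) : EPA (x ≡ x)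
| eq0_sym G (x y : term G N) : EPA (x ≡ y ⇒ y ≡ x)
| eq0_trans G (x y z : term G N) : EPA (x ≡ y ⇒ y ≡ z ⇒ x ≡ z)
| extensionality G r s (z : term G (r ⟶ s)) (x y : term G r) :
    EPA (eqf x y ⇒ eqf (z · x) (z · y))
| succ_not_zero G (x : term G N) : EPA (Succ · x ≡ Zero ⇒ Bot)
| succ_inj G (x y : term G N) : EPA (Succ · x ≡ Succ · y ⇒ x ≡ y)
| Pi_eq G r s (x : term G r) (y : term G s) : EPA (eqf (Pi r s · x · y) x)
| Sigma_eq G r s t (x : term G (r ⟶ s ⟶ t)) (y : term G (r ⟶ s)) (z : term G r) :
    EPA (eqf (Sigma r s t · x · y · z) (x · z · (y · z)))
| Rec_zero G r (y : term G r) (z : term G (r ⟶ N ⟶ r)) :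
    EPA (eqf (Rec r · Zero · y · z) y)
| Rec_succ G r (x : term G N) (y : term G r) (z : term G (r ⟶ N ⟶ r)) :
    EPA (eqf (Rec r · (Succ · x) · y · z) (z · (Rec r · x · y · z) · x))
| induction G (A : form (N :: G)) (hA : internal A) :
    EPA ((inst A Zero ∧ All N (A ⇒ at_succ A)) ⇒ All N A).

Inductive EPAst : forall G, form G -> Prop :=
| from_EPA G (A : form G) : EPA A -> EPAst A
| st_eq G s (x y : term G s) : EPAst (eqf x y ⇒ St x ⇒ St y)
| st_maj G s (x y : term G s) : EPAst (St y ⇒ maj x y ⇒ St x)
| st_closed G s (t : term [] s) : EPAst (St (tsub (@none G) t))
| st_app G r s (z : term G (r ⟶ s)) (x : term G r) : EPAst (St z ⇒ St x ⇒ St (z · x))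
| external_induction G (A : form (N :: G)) :
    EPAst ((inst A Zero ∧ AllSt N (A ⇒ at_succ A)) ⇒ AllSt N A).

(** In the three schemes of [M], [A = A(x, y)] has [y] as index 0 and [x] as index 1. *)
Inductive M : forall G, form G -> Prop :=
| from_EPAst G (A : form G) : EPAst A -> M A
| mAC G r s (A : form (s :: r :: G)) (hA : internal A) :
    M (AllStM r (ExStM s A) ⇒
       ExStM (r ⟶ s) (AllStM r (ExMaj (v1 · v0) (skip2 A))))
| realization G r s (A : form (s :: r :: G)) (hA : internal A) :
    M (All r (ExSt s A) ⇒ ExStM s (All r (ExMaj v1 (skip2 A))))
| MAJ G s : M (AllSt s (ExSt s (maj v1 v0)) : form G).

Inductive derives (Ax : forall G, form G -> Prop) :
    forall G, list (form G) -> form G -> Prop :=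
| axiom G L (A : form G) : Ax G A -> derives Ax L A
| hyp G L (A : form G) : In A L -> derives Ax L A
| impI G L (A B : form G) : derives Ax (A :: L) B -> derives Ax L (A ⇒ B)
| impE G L (A B : form G) : derives Ax L (A ⇒ B) -> derives Ax L A -> derives Ax L B
| andI G L (A B : form G) : derives Ax L A -> derives Ax L B -> derives Ax L (A ∧ B)
| andE1 G L (A B : form G) : derives Ax L (A ∧ B) -> derives Ax L A
| andE2 G L (A B : form G) : derives Ax L (A ∧ B) -> derives Ax L B
| orI1 G L (A B : form G) : derives Ax L A -> derives Ax L (A ∨ B)
| orI2 G L (A B : form G) : derives Ax L B -> derives Ax L (A ∨ B)
| orE G L (A B C : form G) :
    derives Ax L (A ∨ B) -> derives Ax (A :: L) C -> derives Ax (B :: L) C -> derives Ax L C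
| raa G L (A : form G) : derives Ax ((A ⇒ Bot) :: L) Bot -> derives Ax L A
| allI G L s (A : form (s :: G)) : derives Ax (map fwk L) A -> derives Ax L (All s A)
| allE G L s (A : form (s :: G)) (t : term G s) :
    derives Ax L (All s A) -> derives Ax L (inst A t)
| exI G L s (A : form (s :: G)) (t : term G s) :
    derives Ax L (inst A t) -> derives Ax L (Ex s A)
| exE G L s (A : form (s :: G)) (C : form G) :
    derives Ax L (Ex s A) -> derives Ax (A :: map fwk L) (fwk C) -> derives Ax L C.

Definition proves (Ax : forall G, form G -> Prop) (A : form []) : Prop := derives Ax [] A.

(** [f ≈_1 g] *)
Definition approx1 {G} (f g : term G Ty1) : form G :=
  AllSt N (wk f · v0 ≡ wk g · v0).

(** [f ≤_1 h] *)
Definition le1 {G} (f h : term G Ty1) : form G :=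
  All N (le0 (wk f · v0) (wk h · v0)).

(** [f ≤_1 1] *)
Definition binary {G} (f : term G Ty1) : form G :=
  All N (le0 (wk f · v0) (Succ · Zero)).

(** [approx1 f g → phi(f) = phi(g)], with [f], [g] the indices 1 and 0. *)
Definition respects_approx {G} (phi : term G Ty2) : form (Ty1 :: Ty1 :: G) :=
  approx1 v1 v0 ⇒ wk (wk phi) · v1 ≡ wk (wk phi) · v0.

(** The quantifiers range over standard arguments; [phi] itself need not be standard. *)
Definition standard_extensional {G} (phi : term G Ty2) : form G :=
  AllSt Ty1 (AllSt Ty1 (respects_approx phi)).

Definition ns_unif_cont_on_Cantor {G} (phi : term G Ty2) : form G :=
  All Ty1 (All Ty1 ((binary v1 ∧ binary v0) ⇒ respects_approx phi)).

Definition ns_unif_cont_below {G} (phi : term G Ty2) (h : term G Ty1) : form G :=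
  All Ty1 (All Ty1 ((le1 v1 (wk (wk h)) ∧ le1 v0 (wk (wk h))) ⇒ respects_approx phi)).

(* Main.v *)
Require Import Defs.
From Stdlib Require Import List.
Import ListNotations.

Set Implicit Arguments.
Unset Strict Implicit.

Arguments wk : simpl never.

(** Over [M] the theorem is a statement about standardness rather than about
    continuity: every point of a standard compact subspace of Baire space is
    itself standard, so standard extensionality of [phi] already speaks about all
    pairs of points of that subspace.

    To see this, let [h] be standard and [f ≤_1 h].  By [MAJ] there is a standard
    [y] with [h ≤* y].  For [u ≤ v] one has [f u ≤ h u ≤ y v] and [y u ≤ y v],
    hence [f ≤* y] ([maj_of_le1]), and everything strongly majorized by a standard
    object is standard ([st_of_le1]).

    Cantor space is the case where [h] is the constant function [1], a closed
    combinator term and therefore standard.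

    The only arithmetic used is transitivity of [≤] at type [N].  Since [x ≤ y] is
    defined by a witness [d] with [x + d = y], it amounts to associativity of
    addition ([plus_assoc]), proved by internal induction from the recursion
    equations that the combinators provide for [plus]. *)

(** * Substitution *)

(** The composite [h] is constrained only pointwise, so that callers may present it
    in any form for which the constraint holds by computation; this replaces
    rewriting with equations between substitutions, which are functions. *)
Lemma tsub_tsub G D E (f : sub G D) (g : sub D E) (h : sub G E) :
  (forall s (x : var G s), tsub g (f s x) = h s x) ->
  forall s (t : term G s), tsub g (tsub f t) = tsub h t.
Proof.
  intros H s t; induction t; simpl; try reflexivity; [apply H|now rewrite IHt1, IHt2].
Qed.

Lemma tsub_ids G s (t : term G s) : tsub ids t = t.
Proof. induction t; simpl; try reflexivity; now rewrite IHt1, IHt2. Qed.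

Lemma tsub_scons_wk G D r (u : term D r) (f : sub G D) s (t : term G s) :
  tsub (scons u f) (wk t) = tsub f t.
Proof. now apply tsub_tsub. Qed.

Lemma tsub_inst_wk G r (u : term G r) s (t : term G s) :
  tsub (scons u ids) (wk t) = t.
Proof. now rewrite tsub_scons_wk, tsub_ids. Qed.

Lemma tsub_up_wk G D r (f : sub G D) s (t : term G s) :
  tsub (up (r := r) f) (wk t) = wk (tsub f t).
Proof.
  unfold wk at 2; rewrite (tsub_tsub (h := fun s x => wk (f s x))) by reflexivity.
  now apply tsub_tsub.
Qed.

Lemma fsub_eqf s G D (f : sub G D) (x y : term G s) :
  fsub f (eqf x y) = eqf (tsub f x) (tsub f y).
Proof.
  revert G D f x y; induction s as [|r _ t IH]; intros; simpl; [reflexivity|].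
  rewrite IH; simpl; now rewrite !tsub_up_wk.
Qed.

Lemma fsub_le0 G D (f : sub G D) (x y : term G N) :
  fsub f (le0 x y) = le0 (tsub f x) (tsub f y).
Proof. unfold le0, plus; simpl; now rewrite !tsub_up_wk. Qed.

Lemma fsub_maj s G D (f : sub G D) (x y : term G s) :
  fsub f (maj x y) = maj (tsub f x) (tsub f y).
Proof.
  revert G D f x y; induction s as [|r IHr t IHt]; intros; simpl; [apply fsub_le0|].
  rewrite !IHr, !IHt; simpl; now rewrite !tsub_up_wk.
Qed.

Lemma fsub_le1 G D (f : sub G D) (x y : term G Ty1) :
  fsub f (le1 x y) = le1 (tsub f x) (tsub f y).
Proof. unfold le1; cbn [fsub]; rewrite fsub_le0; simpl; now rewrite !tsub_up_wk. Qed.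

Lemma fsub_approx1 G D (f : sub G D) (x y : term G Ty1) :
  fsub f (approx1 x y) = approx1 (tsub f x) (tsub f y).
Proof. unfold approx1, AllSt; simpl; now rewrite !tsub_up_wk. Qed.

(** * Derived rules *)

Lemma derives_mono (Ax Ax' : forall G, form G -> Prop) :
  (forall G (A : form G), Ax G A -> Ax' G A) ->
  forall G (L : list (form G)) A, derives Ax L A -> derives Ax' L A.
Proof. intros H G L A d; induction d; eauto using derives. Qed.

Lemma derives_M_of_EPA G (L : list (form G)) A : derives EPA L A -> derives M L A.
Proof. apply derives_mono; intros; now apply from_EPAst, from_EPA. Qed.

Section Rules.
Context {Ax : forall G, form G -> Prop} {G : ctx} {L : list (form G)}.

Lemma eqf_app r s (x y : term G (r ⟶ s)) (u : term G r) :
  derives Ax L (eqf x y) -> derives Ax L (eqf (x · u) (y · u)).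
Proof.
  intros H; apply (allE u) in H; revert H.
  unfold inst; rewrite fsub_eqf; simpl; now rewrite !tsub_inst_wk.
Qed.

Lemma le0_intro (x y d : term G N) :
  derives Ax L (plus x d ≡ y) -> derives Ax L (le0 x y).
Proof.
  intros H; apply (exI (t := d)).
  unfold inst, plus; simpl; now rewrite !tsub_inst_wk.
Qed.

Lemma le1_elim (f h : term G Ty1) (n : term G N) :
  derives Ax L (le1 f h) -> derives Ax L (le0 (f · n) (h · n)).
Proof.
  intros H; apply (allE n) in H; revert H.
  unfold inst; rewrite fsub_le0; simpl; now rewrite !tsub_inst_wk.
Qed.

Lemma maj_elim r s (x y : term G (r ⟶ s)) (u v : term G r) :
  derives Ax L (maj x y) -> derives Ax L (maj u v) ->
  derives Ax L (maj (x · u) (y · v) ∧ maj (y · u) (y · v)).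
Proof.
  intros H Huv; apply (allE v), (allE u) in H.
  refine (impE _ Huv); revert H.
  unfold inst; simpl; rewrite !fsub_maj; simpl.
  now rewrite !tsub_up_wk, !tsub_inst_wk.
Qed.

End Rules.

(** * Arithmetic at type [N] *)

Section Arithmetic.
Context {G : ctx} {L : list (form G)}.

Lemma eqN_sym (x y : term G N) : derives EPA L (x ≡ y) -> derives EPA L (y ≡ x).
Proof. apply impE, axiom, eq0_sym. Qed.

Lemma eqN_trans (x y z : term G N) :
  derives EPA L (x ≡ y) -> derives EPA L (y ≡ z) -> derives EPA L (x ≡ z).
Proof. intros H; apply impE; revert H; apply impE, axiom, eq0_trans. Qed.

Lemma eqf_arg r s (z : term G (r ⟶ s)) (x y : term G r) :
  derives EPA L (eqf x y) -> derives EPA L (eqf (z · x) (z · y)).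
Proof. apply impE, axiom, extensionality. Qed.

Lemma plus_congr_l (x y d : term G N) :
  derives EPA L (x ≡ y) -> derives EPA L (plus x d ≡ plus y d).
Proof.
  intros H; apply (eqf_app (x := Rec N · d · x) (y := Rec N · d · y) _).
  now apply eqf_arg.
Qed.

Lemma plus_congr_r (x d e : term G N) :
  derives EPA L (d ≡ e) -> derives EPA L (plus x d ≡ plus x e).
Proof.
  intros H; apply (eqf_app (x := Rec N · d · x) (y := Rec N · e · x) _).
  now apply eqf_app, eqf_arg.
Qed.

Lemma plus_zero (x : term G N) : derives EPA L (plus x Zero ≡ x).
Proof. exact (axiom L (Rec_zero (r := N) x _)). Qed.

Lemma plus_succ (x y : term G N) :
  derives EPA L (plus x (Succ · y) ≡ Succ · plus x y).
Proof.
  eapply eqN_trans; [exact (axiom L (Rec_succ (r := N) y x _))|].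
  fold (plus x y); generalize (plus x y) as u; intros u.
  (* The step combinator applied to [u] and [y] reduces to [Succ · u]:
     unfold [Sigma], then the outer [Pi], then the inner one. *)
  eapply eqN_trans; [exact (eqf_app (s := N) y (axiom L (Sigma_eq _ _ u)))|].
  eapply eqN_trans;
    [exact (eqf_app (s := N) y (eqf_app (Succ · u) (axiom L (Pi_eq (Pi N N) u))))|].
  exact (axiom L (Pi_eq (r := N) (Succ · u) y)).
Qed.

End Arithmetic.

Lemma plus_assoc G (L : list (form G)) (x y z : term G N) :
  derives EPA L (plus (plus x y) z ≡ plus x (plus y z)).
Proof.
  set (A := plus (plus (wk x) (wk y)) v0 ≡ plus (wk x) (plus (wk y) v0)).
  assert (inst_A : forall t, inst A t = (plus (plus x y) t ≡ plus x (plus y t))).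
  { intros t; unfold inst, A, plus; simpl; now rewrite !tsub_inst_wk. }
  rewrite <- inst_A; apply allE; refine (impE (axiom _ (induction (A := A) I)) _).
  apply andI.
  - rewrite inst_A.
    eapply eqN_trans; [apply plus_zero|apply eqN_sym, plus_congr_r, plus_zero].
  - apply allI, impI.
    replace (at_succ A) with
      (plus (plus (wk x) (wk y)) (Succ · v0)
         ≡ plus (wk x) (plus (wk y) (Succ · v0)))
      by (unfold at_succ, A, plus; simpl; now rewrite !tsub_scons_wk).
    eapply eqN_trans; [apply plus_succ|].
    eapply eqN_trans;
      [|apply eqN_sym; eapply eqN_trans; [apply plus_congr_r, plus_succ|apply plus_succ]].
    apply (eqf_arg (r := N) (s := N)), hyp; now left.
Qed.

Lemma le0_trans G (L : list (form G)) (x y z : term G N) :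
  derives EPA L (le0 x y ⇒ le0 y z ⇒ le0 x z).
Proof.
  apply impI, impI.
  eapply exE; [apply hyp; right; now left|].
  eapply exE; [apply hyp; right; now left|].
  simpl; unfold fwk; rewrite !fsub_le0.
  (* The two witnesses are [v1], for [x ≤ y], and [v0], for [y ≤ z]. *)
  apply (le0_intro (d := plus v1 v0)).
  eapply eqN_trans; [apply eqN_sym, plus_assoc|].
  eapply eqN_trans; [apply plus_congr_l, hyp; right; left; reflexivity|].
  apply hyp; left; unfold plus; simpl; now rewrite !tsub_up_wk.
Qed.

Lemma le0_eq_r G (L : list (form G)) (x y z : term G N) :
  derives EPA L (y ≡ z ⇒ le0 x y ⇒ le0 x z).
Proof.
  apply impI, impI.
  eapply exE; [apply hyp; now left|].
  simpl; unfold fwk; rewrite !fsub_le0.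
  apply (le0_intro (d := v0)).
  eapply eqN_trans; apply hyp; [now left|].
  right; right; now left.
Qed.

(** * Points below a standard function are standard *)

(** Monotonicity enters through the majorant: it turns the pointwise bound of [f] at
    [u] into a bound at every [v] above [u]. *)
Lemma maj_of_le1 G (L : list (form G)) (f h y : term G Ty1) :
  derives EPA L (le1 f h ⇒ maj h y ⇒ maj f y).
Proof.
  apply impI, impI, allI, allI, impI.
  set (L' := _ :: map _ _).
  (* Here [u] is index 0 and [v] is index 1, with [u ≤ v]. *)
  assert (Hle : derives EPA L' (le1 (wk (wk f)) (wk (wk h)))).
  { apply hyp; right; right; left; unfold fwk; now rewrite !fsub_le1. }
  assert (Hmaj : derives EPA L' (maj (wk (wk h)) (wk (wk y)))).
  { apply hyp; right; left; unfold fwk; now rewrite !fsub_maj. }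
  assert (Huv : derives EPA L' (maj (v0 : term (N :: N :: G) N) v1)).
  { apply hyp; now left. }
  assert (H := maj_elim Hmaj Huv).
  apply andI; [|exact (andE2 H)].
  exact (impE (impE (le0_trans _ _ _ _) (le1_elim _ Hle)) (andE1 H)).
Qed.

(** The bound fed to [st_maj] is a majorant of [h]: [f ≤* h] itself fails whenever
    [h] is not monotone. *)
Lemma st_of_le1 G (L : list (form G)) (f h : term G Ty1) :
  derives M L (St h ⇒ le1 f h ⇒ St f).
Proof.
  apply impI, impI.
  assert (H : derives M (le1 f h :: St h :: L) (ExSt Ty1 (maj (wk h) v0))).
  { refine (impE _ (hyp _ _)); [|right; now left].
    exact (allE h (axiom _ (MAJ G Ty1))). }
  apply (exE H); clear H.
  set (L' := _ :: map _ _).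
  assert (Hy : derives M L' (St v0 ∧ maj (wk h) v0)) by (apply hyp; now left).
  assert (Hle : derives M L' (le1 (wk f) (wk h))).
  { apply hyp; right; left; unfold fwk; now rewrite fsub_le1. }
  refine (impE (impE (axiom _ (from_EPAst (st_maj (wk f) v0))) (andE1 Hy)) _).
  exact (impE (impE (derives_M_of_EPA (maj_of_le1 _ _ _ _)) Hle) (andE2 Hy)).
Qed.

Lemma unif_cont_below_standard G (L : list (form G)) (phi : term G Ty2)
    (h : term G Ty1) :
  derives M L (St h ⇒ standard_extensional phi ⇒ ns_unif_cont_below phi h).
Proof.
  apply impI, impI, allI, allI, impI.
  set (L' := _ :: map _ _).
  assert (Hh : derives M L' (St (wk (wk h)))) by (apply hyp; right; right; now left).
  assert (Hle : derives M L' (le1 v1 (wk (wk h)) ∧ le1 v0 (wk (wk h))))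
    by (apply hyp; now left).
  assert (Hf := impE (impE (st_of_le1 _ _ _) Hh) (andE1 Hle)).
  assert (Hg := impE (impE (st_of_le1 _ _ _) Hh) (andE2 Hle)).
  assert (E : derives M L' (standard_extensional (wk (wk phi)))).
  { apply hyp; right; left.
    unfold fwk, standard_extensional, respects_approx, AllSt; cbn [fsub].
    rewrite !fsub_approx1; simpl; now rewrite !tsub_up_wk. }
  refine (impE _ Hg).
  apply (allE v1) in E; unfold inst in E; cbn [fsub] in E.
  assert (E' := impE E Hf); apply (allE v0) in E'; revert E'.
  unfold inst, respects_approx; cbn [fsub].
  rewrite !fsub_approx1; simpl; now rewrite !tsub_up_wk, !tsub_inst_wk.
Qed.

Definition const1 {G} : term G Ty1 := Pi N N · (Succ · Zero).

(** [binary f] compares [f n] with the numeral itself, so the equation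
    [const1 n = 1] has to be used inside the theory. *)
Lemma le1_const1 G (L : list (form G)) (f : term G Ty1) :
  derives EPA L (binary f ⇒ le1 f const1).
Proof.
  apply impI, allI.
  refine (impE (impE (le0_eq_r _ _ _ _)
                     (eqN_sym (axiom _ (Pi_eq (r := N) (Succ · Zero) v0)))) _).
  assert (H : derives EPA (map (@fwk G N) (binary f :: L)) (binary (wk f))).
  { apply hyp; left; unfold fwk, binary; cbn [fsub].
    rewrite fsub_le0; simpl; now rewrite tsub_up_wk. }
  apply (allE v0) in H; revert H.
  unfold inst; rewrite fsub_le0; simpl; now rewrite tsub_inst_wk.
Qed.

Lemma unif_cont_on_Cantor_of_below G (L : list (form G)) (phi : term G Ty2) :
  derives M L (ns_unif_cont_below phi const1 ⇒ ns_unif_cont_on_Cantor phi).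
Proof.
  apply impI, allI, allI, impI.
  set (L' := _ :: map _ _).
  assert (Hb : derives M L' (binary v1 ∧ binary v0)) by (apply hyp; now left).
  assert (H : derives M L' (ns_unif_cont_below (wk (wk phi)) const1)).
  { apply hyp; right; left.
    unfold fwk, ns_unif_cont_below, respects_approx; cbn [fsub].
    rewrite !fsub_approx1, !fsub_le1; simpl; now rewrite !tsub_up_wk. }
  apply (allE v1) in H; unfold inst, respects_approx in H; cbn [fsub] in H.
  apply (allE v0) in H; unfold inst in H; cbn [fsub] in H; revert H.
  rewrite !fsub_approx1, !fsub_le1; simpl; rewrite !tsub_up_wk, !tsub_inst_wk.
  intros H; refine (impE H _).
  apply andI; refine (impE (derives_M_of_EPA (le1_const1 _ _)) _).
  - exact (andE1 Hb).
  - exact (andE2 Hb).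
Qed.

(* In the second conjunct index 1 is h0 and index 0 is phi. *)
Theorem corollary1p12 :
  proves M (All Ty2 (standard_extensional v0 ⇒ ns_unif_cont_on_Cantor v0)) /\
  proves M (AllSt Ty1 (All Ty2 (standard_extensional v0 ⇒ ns_unif_cont_below v0 v1))).
Proof.
  split.
  - apply allI, impI.
    refine (impE (unif_cont_on_Cantor_of_below _ _) _).
    refine (impE (impE (unif_cont_below_standard _ _ _) _) _).
    + exact (axiom _ (from_EPAst (st_closed _ const1))).
    + apply hyp; now left.
  - apply allI, impI, allI.
    refine (impE (unif_cont_below_standard _ _ _) _).
    apply hyp; now left.
Qed.
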